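(* Let $\mathcal{M}=(X,\mathcal{I})$ be a matroid and $f:2^X\to\mathbb{R}_{\ge0}$ a nonnegative submodular function such that both $f$ and $\mathcal{I}$ are invariant under an element-transitive group $\mathcal{G}$ of permutations of $X$. Let $OPT=\max\{f(S):S\in\mathcal{I}\}$ and $\overline{OPT}=\max\{F(\bar{\mathbf{x}}):\mathbf{x}\in P(\mathcal{M})\}$, where $F$ is the multilinear extension of $f$, $P(\mathcal{M})=\mathrm{conv}\{\mathbf{1}_I:I\in\mathcal{I}\}$ and $\bar{\mathbf{x}}=\mathbf{E}_{\sigma\in\mathcal{G}}[\sigma(\mathbf{x})]$. Then $\overline{OPT}\ge\frac12 OPT$.
   Context: The multilinear extension is $F(\mathbf{x})=\sum_{S\subseteq X}f(S)\prod_{i\in S}x_i\prod_{j\notin S}(1-x_j)$. Invariance: $f(\sigma(S))=f(S)$ and $S\in\mathcal{I}\Leftrightarrow\sigma(S)\in\mathcal{I}$ for $\sigma\in\mathcal{G}$. $\mathcal{G}$ is element-transitive if for every $i\in X$, $\{\sigma(i):\sigma\in\mathcal{G}\}=X$. $\sigma(\mathbf{x})$ is $\mathbf{x}$ with coordinates permuted by $\sigma$; expectation over uniform $\sigma\in\mathcal{G}$. *)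

(* Defs.v *)
From HB Require Import structures.
From mathcomp Require Import all_boot all_order all_algebra all_fingroup.
From mathcomp Require Import boolp classical_sets reals convex.

Set Implicit Arguments.
Unset Strict Implicit.
Unset Printing Implicit Defensive.

Import Order.TTheory GRing.Theory Num.Theory.

Local Open Scope ring_scope.

Definition is_matroid (X : finType) (I : {set {set X}}) : Prop :=
  [/\ finset.set0 \in I,
      forall A B : {set X}, A \subset B -> B \in I -> A \in I
    & forall A B : {set X}, A \in I -> B \in I -> (#|A| < #|B|)%N ->
        exists2 x, x \in B :\: A & x |: A \in I].

Definition submodular (R : realType) (X : finType) (f : {set X} -> R) : Prop :=
  forall A B : {set X}, f (A :|: B) + f (A :&: B) <= f A + f B.

Definition invariant_fun (R : realType) (X : finType) (G : {group {perm X}})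
    (f : {set X} -> R) : Prop :=
  forall (s : {perm X}) (S : {set X}), s \in G -> f (s @: S) = f S.

Definition invariant_family (X : finType) (G : {group {perm X}})
    (I : {set {set X}}) : Prop :=
  forall (s : {perm X}) (S : {set X}), s \in G -> (S \in I) = (s @: S \in I).

(* Unlike [transitive G, on setT | 'P], this also holds when X is empty. *)
Definition element_transitive (X : finType) (G : {group {perm X}}) : Prop :=
  forall i : X, (fun s : {perm X} => s i) @: G = finset.setT.

(* R^o is R viewed as a module over itself, so that {ffun X -> R^o} is the
   R-vector space R^X. *)
Definition indicator (R : realType) (X : finType) (S : {set X}) :
    {ffun X -> R^o} := [ffun i => (i \in S)%:R].

Definition convex_hull (R : realType) (V : lmodType R) (A : set V) : set V :=
  smallest (@convex_set R V) A.

Definition matroid_polytope (R : realType) (X : finType) (I : {set {set X}}) :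
    set {ffun X -> R^o} :=
  convex_hull [set indicator R S | S in [set` I]]%classic.

Definition multilinear (R : realType) (X : finType) (f : {set X} -> R)
    (x : {ffun X -> R^o}) : R :=
  \sum_(S : {set X})
    f S * ((\prod_(i in S) (x i : R)) * (\prod_(j | j \notin S) (1 - x j : R))).

(* The value x i moves from coordinate i to coordinate s i; hence
   permute s (indicator R S) = indicator R (s @: S). *)
Definition permute (R : realType) (X : finType) (s : {perm X})
    (x : {ffun X -> R^o}) : {ffun X -> R^o} := [ffun i => x ((s^-1)%g i)].

Definition symmetrize (R : realType) (X : finType) (G : {group {perm X}})
    (x : {ffun X -> R^o}) : {ffun X -> R^o} :=
  (#|G|%:R : R)^-1 *: \sum_(s in G) permute s x.

Definition is_max (R : realType) (A : set R) (m : R) : Prop :=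
  A m /\ ubound A m.

(* Main.v *)
(* Transitivity makes every symmetrized vector constant, so OPTbar is the maximum
   of [F(t, ..., t)] over a segment, which is attained because this is a
   polynomial in [t].  For an optimal set [S], the vector [indicator S] has mean
   [t = |S| / |X|]; let [T] contain each element independently with probability
   [t].  Submodularity bounds [f (T :|: S) + f (T :&: S) - 2 f T] by a sum of
   single-element marginals whose expectation is the derivative of [F] at
   [(t, ..., t)] in the direction [indicator S - (t, ..., t)].  By symmetry this
   derivative is [0], so [2 F(t, ..., t) >= E f (T :|: S) + E f (T :&: S)].
   Submodularity and nonnegativity bound the two expectations below by
   [(1 - t) f S] and [t f S]. *)
Require Import Defs.
From HB Require Import structures.
From mathcomp Require Import all_boot all_order all_algebra all_fingroup.
From mathcomp Require Import boolp classical_sets reals convex.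
From mathcomp Require Import interval_inference topology normedtype derive.
From mathcomp Require Import ring lra.

Set Implicit Arguments.
Unset Strict Implicit.
Unset Printing Implicit Defensive.

Import Order.TTheory GRing.Theory Num.Theory.
Import numFieldNormedType.Exports.

Local Open Scope ring_scope.

Definition const_vec (R : realType) (X : finType) (t : R) : {ffun X -> R^o} :=
  [ffun=> t].

(* The expectation of [h T] when [T] contains every element independently with
   probability [t]. *)
Local Notation E_ t h := (multilinear h (const_vec _ t)).

(** * Expectations over a random set with independent elements *)

Section MultilinearConst.
Variables (R : realType) (X : finType).
Implicit Types (h : {set X} -> R) (t : R) (T S : {set X}).

Lemma multilinear_constE t h :
  E_ t h = \sum_S h S * (t ^+ #|S| * (1 - t) ^+ #|~: S|).
Proof.
apply: eq_bigr => S _; congr (_ * (_ * _)).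
  by rewrite (eq_bigr (fun=> t)) ?prodr_const// => i _; rewrite ffunE.
rewrite (eq_bigr (fun=> 1 - t)) => [|i _]; last by rewrite ffunE.
by rewrite -prodr_const; apply: eq_bigl => i; rewrite inE.
Qed.

Lemma ler_multilinear_const t h1 h2 : 0 <= t <= 1 ->
  (forall T, h1 T <= h2 T) -> E_ t h1 <= E_ t h2.
Proof.
move=> /andP[t0 t1] le_h; rewrite !multilinear_constE; apply: ler_sum => S _.
by rewrite ler_wpM2r// mulr_ge0// exprn_ge0// subr_ge0.
Qed.

Lemma eq_multilinear (x : {ffun X -> R^o}) h1 h2 :
  h1 =1 h2 -> multilinear h1 x = multilinear h2 x.
Proof. by move=> eq_h; apply: eq_bigr => S _; rewrite eq_h. Qed.

Lemma multilinearD (x : {ffun X -> R^o}) h1 h2 :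
  multilinear (fun T => h1 T + h2 T) x = multilinear h1 x + multilinear h2 x.
Proof.
by rewrite /multilinear -big_split/=; apply: eq_bigr => S _; rewrite mulrDl.
Qed.

Lemma multilinearZ (x : {ffun X -> R^o}) a h :
  multilinear (fun T => a * h T) x = a * multilinear h x.
Proof.
by rewrite /multilinear mulr_sumr; apply: eq_bigr => S _; rewrite [RHS]mulrA.
Qed.

Lemma multilinear_sum (x : {ffun X -> R^o}) (J : finType) (P : pred J)
    (h : J -> {set X} -> R) :
  multilinear (fun T => \sum_(j | P j) h j T) x =
  \sum_(j | P j) multilinear (h j) x.
Proof.
by rewrite /multilinear [RHS]exchange_big/=; apply: eq_bigr => S _; rewrite mulr_suml.
Qed.

(** The weights are the expansion of the product over [i] of [x i + (1 - x i)], so they sum to 1. *)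
Lemma multilinear_cst (x : {ffun X -> R^o}) a :
  multilinear (fun=> a) x = a.
Proof.
rewrite /multilinear -mulr_sumr -[RHS]mulr1; congr (_ * _).
transitivity (\prod_(i : X) ((x i : R) + (1 - x i))); last first.
  by rewrite big1// => i _; rewrite addrC subrK.
rewrite bigA_distr; apply: eq_bigr => S _.
rewrite [RHS](bigID (fun i => i \in S))/=; congr (_ * _).
  by apply: eq_bigr => i ->.
by apply: eq_bigr => i /negbTE ->.
Qed.

(** At a constant vector the weight of a set depends only on its cardinality, which [s]
    preserves. *)
Lemma multilinear_const_perm (s : {perm X}) t h :
  E_ t (fun T => h (s @: T)) = E_ t h.
Proof.
have inj_s : injective (fun T : {set X} => s @: T).
  exact/imset_inj/perm_inj.
rewrite !multilinear_constE [RHS](reindex_inj inj_s)/=.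
apply: eq_bigr => S _.
have cardC (A : {set X}) : #|~: A| = (#|X| - #|A|)%N.
  by rewrite cardsCs finset.setCK.
by rewrite !cardC card_imset//; exact: perm_inj.
Qed.

(** Pair each [T] avoiding [i] with [i |: T]: the weight of the latter times [1 - t] is the weight
    of the former times [t]. *)
Lemma multilinear_const_shift t i h :
  (1 - t) * E_ t (fun T => (i \in T)%:R * h T) =
  t * E_ t (fun T => (i \notin T)%:R * h (i |: T)).
Proof.
rewrite !multilinear_constE !mulr_sumr.
rewrite (bigID (fun T : {set X} => i \in T))/= [X in _ + X]big1 ?addr0;
  last by move=> T /negbTE ->; rewrite !mul0r mulr0.
rewrite [RHS](bigID (fun T : {set X} => i \notin T))/= [X in _ = _ + X]big1 ?addr0;
  last by move=> T /negbTE ->; rewrite !mul0r mulr0.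
rewrite (reindex_onto (fun T => i |: T) (fun T => T :\ i))/=; last first.
  by move=> T iT; rewrite finset.setD1K.
have eqP T : (i \in i |: T) && ((i |: T) :\ i == T) = (i \notin T).
  rewrite setU11/=; apply/eqP/idP => [<-|/setU1K//].
  by rewrite !inE eqxx.
rewrite (eq_bigl _ _ eqP); apply: eq_bigr => T iT.
rewrite setU11 (iT : i \notin T = true) !mul1r cardsU1 iT add1n exprS.
have -> : #|~: T| = #|~: (i |: T)|.+1.
  by rewrite (cardsD1 i (~: T)) inE iT finset.setDE finset.setCU finset.setIC.
by rewrite exprS; ring.
Qed.

Lemma multilinear_const_mem t i : E_ t (fun T => (i \in T)%:R) = t.
Proof.
(* With [h = 1] the shift identity reads [(1 - t) * p = t * (1 - p)], whence [p = t]. *)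
have := multilinear_const_shift t i (fun=> 1).
rewrite (eq_multilinear _ (h2 := fun T => (i \in T)%:R)) => [|T]; last exact: mulr1.
rewrite [X in _ = t * X](eq_multilinear _
  (h2 := fun T => 1 + (-1) * (i \in T)%:R)) => [|T].
  by rewrite multilinearD multilinear_cst multilinearZ => ?; lra.
by case: (i \in T) => /=; ring.
Qed.

End MultilinearConst.

(** * Inequalities for submodular functions *)

Section Submodular.
Variables (R : realType) (X : finType).
Implicit Types (f g : {set X} -> R) (T S : {set X}).

(* The base polytope of [g] is nonempty: [v] lists the marginal values of [g]
   along an ordering of [V], as in Edmonds' greedy algorithm. *)
Lemma submodular_base g : submodular g -> forall V : {set X}, exists v : X -> R,
  (forall T, T \subset V -> g finset.set0 + \sum_(i in T) v i <= g T) /\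
  g finset.set0 + \sum_(i in V) v i = g V.
Proof.
move=> subg V; have [n] := ubnP #|V|; elim: n => // n IH in V *.
case: (set_0Vmem V) => [-> _|[i iV]].
  exists (fun=> 0); rewrite big_set0 addr0; split=> // T.
  by rewrite finset.subset0 => /eqP ->; rewrite big_set0 addr0.
rewrite (cardsD1 i) iV add1n ltnS => /IH[v [v_le v_eq]].
pose v' j := if j == i then g V - g (V :\ i) else v j.
have v'E T : i \notin T -> \sum_(j in T) v' j = \sum_(j in T) v j.
  move=> iT; apply: eq_bigr => j jT; rewrite /v'.
  by case: eqP jT iT => // -> ->.
have v'i : v' i = g V - g (V :\ i) by rewrite /v' eqxx.
exists v'; split=> [T TV|]; last first.
  by rewrite (big_setD1 i)//= v'E ?setD11// v'i -v_eq; lra.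
have [iT|iT] := boolP (i \in T); last first.
  rewrite v'E// v_le//; apply/subsetD1P; split=> //.
rewrite (big_setD1 i)//= v'E ?setD11// v'i.
have := v_le (T :\ i) (finset.setSD _ TV).
(* The union is [V] and the intersection is [T :\ i], so the marginal of [i] at [T :\ i] is at least
   its marginal [v' i] at [V :\ i]. *)
have := subg T (V :\ i).
have -> : T :|: V :\ i = V.
  apply/setP => j; rewrite !inE; have [->|_] /= := eqVneq j i.
    by rewrite iT iV.
  by apply/orP/idP => [[/(fintype.subsetP TV)|]//|]; right.
have -> : T :&: (V :\ i) = T :\ i.
  apply/setP => j; rewrite !inE andbCA; case: (j == i) => //=.
  by apply: andb_idr => /(fintype.subsetP TV).
lra.
Qed.

(** By [submodular_base], [g] dominates a modular function that agrees with it on the empty and full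
    sets; the expectation of that function is the left-hand side. *)
Lemma multilinear_const_submodular_ge t g : 0 <= t <= 1 -> submodular g ->
  (1 - t) * g finset.set0 + t * g finset.setT <= E_ t g.
Proof.
move=> t01 /submodular_base/(_ finset.setT)[v [v_le v_eq]].
apply: le_trans (ler_multilinear_const t01 (fun T => v_le T (finset.subsetT T))).
rewrite multilinearD multilinear_cst.
rewrite (eq_multilinear _ (h2 := fun T => \sum_i v i * (i \in T)%:R)); last first.
  move=> T; rewrite [LHS]big_mkcond/=; apply: eq_bigr => i _.
  by case: (i \in T); rewrite ?mulr1 ?mulr0.
rewrite multilinear_sum.
under eq_bigr => i _ do rewrite multilinearZ multilinear_const_mem.
rewrite -mulr_suml -v_eq (eq_bigl predT) => [|i]; last by rewrite inE.
by rewrite le_eqVlt; apply/orP; left; apply/eqP; ring.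
Qed.

(** Add the elements of [S] one at a time: by diminishing returns each increment is at most the
    marginal at [T]. *)
Lemma submodular_setU g T S : submodular g ->
  g (T :|: S) - g T <= \sum_(i in S) (g (i |: T) - g T).
Proof.
move=> subg; have [n] := ubnP #|S|; elim: n => // n IH in S *.
case: (set_0Vmem S) => [-> _|[i iS]].
  by rewrite finset.setU0 subrr big_set0.
rewrite (cardsD1 i) iS add1n ltnS (big_setD1 i)//= => /IH le_S.
have [iT|iT] := boolP (i \in T).
  have -> : i |: T = T by apply/finset.setUidPr; rewrite finset.sub1set.
  rewrite subrr add0r; have -> // : T :|: S = T :|: S :\ i.
  apply/setP => j; rewrite !inE; have [->|//] := eqVneq j i.
  by rewrite iT.
have := subg (i |: T) (T :|: S :\ i).
have -> : (i |: T) :|: (T :|: S :\ i) = T :|: S.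
  rewrite finset.setUA -(finset.setUA [set i]%SET) finset.setUid.
  by rewrite (finset.setUC _ T) -finset.setUA finset.setD1K.
have -> : (i |: T) :&: (T :|: S :\ i) = T.
  apply/setP => j; rewrite !inE; case: (j \in T); rewrite ?orbT ?orbF//=.
  by case: (j == i).
lra.
Qed.

Lemma submodular_setC g : submodular g -> submodular (fun T => g (~: T)).
Proof.
move=> subg A B; have := subg (~: A) (~: B).
by rewrite -finset.setCI -finset.setCU addrC.
Qed.

(** Dual to [submodular_setU]: removing elements from [T] adds them to its complement. *)
Lemma submodular_setI g T S : submodular g ->
  g (T :&: S) - g T <= \sum_(i in ~: S) (g (T :\ i) - g T).
Proof.
move=> /submodular_setC/(submodular_setU (~: T) (~: S)).
rewrite -finset.setCI !finset.setCK => /le_trans; apply.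
rewrite le_eqVlt; apply/orP; left; apply/eqP; apply: eq_bigr => i _.
by rewrite finset.setCU finset.setCK finset.setIC -finset.setDE.
Qed.

Lemma submodular_setUr g S : submodular g -> submodular (fun T => g (T :|: S)).
Proof.
by move=> subg A B; have := subg (A :|: S) (B :|: S);
  rewrite -finset.setUIl finset.setUACA finset.setUid.
Qed.

Lemma submodular_setIr g S : submodular g -> submodular (fun T => g (T :&: S)).
Proof.
by move=> subg A B; have := subg (A :&: S) (B :&: S);
  rewrite -finset.setIUl finset.setIACA finset.setIid.
Qed.

End Submodular.

(** * The derivative of the extension along the diagonal points *)

Section Invariant.
Variables (R : realType) (X : finType) (f : {set X} -> R) (G : {group {perm X}}).
Hypotheses (subf : submodular f) (transG : element_transitive G).
Hypothesis (invf : invariant_fun G f).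

Lemma transitive_perm i j : exists2 s, s \in G & s i = j.
Proof.
have : j \in (fun s : {perm X} => s i) @: G by rewrite transG inE.
by case/imsetP => s sG ->; exists s.
Qed.

(** Some [s] in [G] sends [i] to [j], and it preserves both [f] and the law of the random set. *)
Lemma multilinear_const_setU1 t i j :
  E_ t (fun T => f (i |: T) - f T) = E_ t (fun T => f (j |: T) - f T).
Proof.
have [s sG <-] := transitive_perm i j.
rewrite -[RHS](multilinear_const_perm s); apply: eq_multilinear => T.
by rewrite -finset.imset_set1 -finset.imsetU !invf.
Qed.

Lemma multilinear_const_setD1 t i j :
  E_ t (fun T => f (T :\ i) - f T) = E_ t (fun T => f (T :\ j) - f T).
Proof.
have [s sG <-] := transitive_perm i j.
rewrite -[RHS](multilinear_const_perm s); apply: eq_multilinear => T.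
have -> : s @: T :\ s i = s @: (T :\ i); last by rewrite !invf.
apply/setP => k; rewrite -(permKV s k) !inE !mem_imset ?inE; try exact: perm_inj.
by rewrite (inj_eq perm_inj).
Qed.

(** The two terms are plus and minus [t * (1 - t)] times the [i]-th partial derivative of the
    extension. *)
Lemma multilinear_const_stationary t i :
  t * E_ t (fun T => f (i |: T) - f T)
    + (1 - t) * E_ t (fun T => f (T :\ i) - f T) = 0.
Proof.
have := multilinear_const_shift t i (fun T => f T - f (T :\ i)).
rewrite (eq_multilinear _ (h2 := fun T => -1 * (f (T :\ i) - f T))); last first.
  move=> T; case: (boolP (i \in T)) => iT /=; first by ring.
  suff -> : T :\ i = T by ring.
  by apply/finset.setDidPl; rewrite fintype.disjoint_sym disjoints1.
rewrite multilinearZ [X in _ = t * X](eq_multilinear _ (h2 := fun T => f (i |: T) - f T)).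
  by move=> ?; lra.
move=> T; case: (boolP (i \in T)) => iT /=; last by rewrite setU1K// mul1r.
have -> : i |: T = T by apply/finset.setUidPr; rewrite finset.sub1set.
by rewrite subrr mul0r.
Qed.

(* The derivative of [F] at [(t, ..., t)] in the direction
   [indicator S - (t, ..., t)] vanishes, since the partial derivatives agree
   there and the coordinates of the direction sum to [0]. *)
Lemma multilinear_const_local t (S : {set X}) : 0 <= t <= 1 ->
  #|X|%:R * t = #|S|%:R ->
  E_ t (fun T => f (T :|: S)) + E_ t (fun T => f (T :&: S)) <= 2 * E_ t f.
Proof.
move=> t01 tS.
have leT T : f (T :|: S) + f (T :&: S) <= 2 * f T +
    (\sum_(i in S) (f (i |: T) - f T) + \sum_(i in ~: S) (f (T :\ i) - f T)).
  by have := submodular_setU T S subf; have := submodular_setI T S subf; lra.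
rewrite -multilinearD (le_trans (ler_multilinear_const t01 leT))//.
rewrite 2!multilinearD multilinearZ !multilinear_sum.
(* All marginals are transferred to one reference element [i0]; if [X] is empty, both sums
   vanish. *)
have [i0 _|X0] := pickP (pred_of_simpl (@predT X)); last first.
  by rewrite !big1 ?addr0// => i; have := X0 i.
rewrite (eq_bigr _ (fun i _ => multilinear_const_setU1 t i i0)).
rewrite [X in _ + (_ + X) <= _](eq_bigr _
  (fun i _ => multilinear_const_setD1 t i i0)).
rewrite !sumr_const.
have cardC : (#|~: S|%:R : R) = #|X|%:R * (1 - t).
  by rewrite cardsCs finset.setCK natrB ?max_card// -tS; ring.
set a := E_ t (fun T => f (i0 |: T) - f T).
set b := E_ t (fun T => f (T :\ i0) - f T).
have -> : a *+ #|S| + b *+ #|~: S| = #|X|%:R * (t * a + (1 - t) * b).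
  by rewrite -(mulr_natl a) -(mulr_natl b) cardC -tS; ring.
by rewrite multilinear_const_stationary mulr0 addr0.
Qed.

Lemma multilinear_const_half t (S : {set X}) : (forall S, 0 <= f S) ->
  0 <= t <= 1 -> #|X|%:R * t = #|S|%:R -> 2^-1 * f S <= E_ t f.
Proof.
move=> f0 t01 tS; have := multilinear_const_local t01 tS.
have := multilinear_const_submodular_ge t01 (submodular_setUr S subf).
have := multilinear_const_submodular_ge t01 (submodular_setIr S subf).
rewrite finset.set0U finset.set0I finset.setTU finset.setTI.
have /andP[t0 t1] := t01.
(* The two lower bounds add up to [f S] plus this term and the next one. *)
have : 0 <= t * f finset.setT by rewrite mulr_ge0.
have : 0 <= (1 - t) * f finset.set0 by rewrite mulr_ge0// subr_ge0.
lra.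
Qed.

End Invariant.

(** * Symmetrization and the means of polytope points *)

Section Polytope.
Variables (R : realType) (X : finType).
Implicit Types (x : {ffun X -> R^o}) (S : {set X}) (t : R).

Definition mean x : R := #|X|%:R^-1 * \sum_i (x i : R).

Lemma symmetrizeE (G : {group {perm X}}) x :
  element_transitive G -> symmetrize G x = const_vec X (mean x).
Proof.
move=> transG; apply/ffunP => i; rewrite !ffunE sum_ffunE.
pose m j : R := \sum_(s in G) x ((s^-1)%g j).
(* Right translation of [G] by some [u] with [u i = j] turns one sum into the other. *)
have m_const j : m j = m i.
  have [u uG <-] := transitive_perm transG i j.
  rewrite /m (reindex_inj (mulIg u))/=; apply: eq_big => [s|s _].
    by rewrite groupMr.
  by rewrite invMg permM permK.
have sum_m : \sum_j m j = #|G|%:R * \sum_j (x j : R).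
  rewrite exchange_big/= mulr_natl -sumr_const; apply: eq_bigr => s _.
  by rewrite [RHS](reindex_inj (@perm_inj _ (s^-1)%g)).
rewrite (eq_bigr _ (fun j _ => m_const j)) sumr_const -(mulr_natl (m i)) in sum_m.
have X0 : #|X|%:R != 0 :> R by rewrite pnatr_eq0 -lt0n; apply/card_gt0P; exists i.
have G0 : #|G|%:R != 0 :> R by rewrite pnatr_eq0 -lt0n cardG_gt0.
rewrite /mean; set y := \sum_j _ in sum_m *.
have -> : \sum_(s in G) permute s x i = m i.
  by apply: eq_bigr => s _; rewrite ffunE.
change (#|G|%:R^-1 * m i = #|X|%:R^-1 * y).
apply: (mulfI G0); rewrite mulVKf//.
by apply: (mulfI X0); rewrite sum_m; field.
Qed.

Lemma mean_indicator S : mean (indicator R S) = #|S|%:R / #|X|%:R.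
Proof.
rewrite /mean mulrC; congr (_ / _); rewrite -sum1_card natr_sum [RHS]big_mkcond.
by apply: eq_bigr => i _; rewrite ffunE; case: (i \in S).
Qed.

Lemma mean_indicator_itv S : 0 <= mean (indicator R S) <= 1.
Proof.
rewrite mean_indicator mulr_ge0 ?invr_ge0//=.
have [X0|X0] := posnP #|X|; first by rewrite X0 invr0 mulr0.
by rewrite ler_pdivrMr ?ltr0n// mul1r ler_nat max_card.
Qed.

Lemma card_mean_indicator S : #|X|%:R * mean (indicator R S) = #|S|%:R.
Proof.
rewrite mean_indicator mulrC.
have [X0|X0] := posnP #|X|; last by rewrite divfK// pnatr_eq0 -lt0n.
suff -> : #|S| = 0%N by rewrite !mul0r.
by apply/eqP; rewrite -leqn0 -X0 max_card.
Qed.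

Lemma mean_comb a b x y : mean (a *: x + b *: y) = a * mean x + b * mean y.
Proof.
rewrite /mean (eq_bigr (fun i => a * (x i : R) + b * (y i : R))) => [|i _].
  by rewrite big_split -!mulr_sumr/=; ring.
by rewrite !ffunE.
Qed.

Lemma polytope_indicator (I : {set {set X}}) S :
  S \in I -> matroid_polytope I (indicator R S).
Proof. by move=> SI M [_]; apply; exists S. Qed.

(** The vectors with mean in [[0, r]] form a convex set containing the generating indicators, hence
    the whole hull. *)
Lemma polytope_mean_le (I : {set {set X}}) (r : R) :
  (forall S, S \in I -> mean (indicator R S) <= r) ->
  forall x, matroid_polytope I x -> 0 <= mean x <= r.
Proof.
move=> le_r x /(_ [set y | 0 <= mean y <= r]%classic); apply; split; last first.
  move=> _ [S /= SI <-] /=; rewrite le_r// andbT mean_indicator.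
  by rewrite mulr_ge0// invr_ge0.
move=> y z l; rewrite !inE => /andP[y0 yr] /andP[z0 zr] /=.
have l0 : 0 <= l%:inum by [].
have l1 : l%:inum <= 1 by [].
rewrite [mean _]mean_comb/= /unstable.onem; apply/andP; split; first nra.
by nra.
Qed.

Lemma polytope_mean_surj (I : {set {set X}}) S t :
  finset.set0 \in I -> S \in I -> 0 <= t <= mean (indicator R S) ->
  exists2 x, matroid_polytope I x & mean x = t.
Proof.
move=> I0 SI /andP[t0 tS]; set r := mean (indicator R S) in tS *.
have [r0|r_neq0] := eqVneq r 0.
  exists (indicator R S); first exact: polytope_indicator.
  by apply/eqP; rewrite eq_le -/r {1}r0 t0 tS.
have r_gt0 : 0 < r by rewrite lt_def r_neq0 (le_trans t0).
have l0 : 0 <= t / r by rewrite divr_ge0// ltW.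
have l1 : t / r <= 1 by rewrite ler_pdivrMr// mul1r.
(* The mean is affine on the segment from the empty set's indicator (mean 0) to that of [S] (mean
   [r]). *)
exists ((t / r) *: indicator R S + (1 - t / r) *: indicator R finset.set0).
  move=> M MI; have [convM _] := MI.
  apply: set_mem; apply: (convM _ _ (Itv01 l0 l1)); rewrite inE;
    exact: polytope_indicator MI.
by rewrite mean_comb (mean_indicator finset.set0) cards0 mul0r mulr0 addr0 -/r divfK.
Qed.

Lemma continuous_multilinear_const (h : {set X} -> R) :
  continuous (fun t => multilinear h (const_vec X t)).
Proof.
pose p : {poly R} := \sum_S h S *: ('X^#|S| * (1 - 'X) ^+ #|~: S|).
have -> : (fun t => multilinear h (const_vec X t)) = horner p.
  apply/funext => t; rewrite multilinear_constE horner_sum.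
  by apply: eq_bigr => S _; rewrite !hornerE.
exact: continuous_horner.
Qed.

End Polytope.

Theorem theorem5p4 (R : realType) (X : finType) (I : {set {set X}})
    (f : {set X} -> R) (G : {group {perm X}}) :
  is_matroid I ->
  (forall S : {set X}, 0 <= f S) ->
  submodular f ->
  element_transitive G ->
  invariant_fun G f ->
  invariant_family G I ->
  exists OPT OPTbar : R,
    [/\ is_max [set f S | S in [set` I]]%classic OPT,
        is_max [set multilinear f (symmetrize G x) | x in matroid_polytope I]%classic
          OPTbar
      & 2^-1 * OPT <= OPTbar].
Proof.
move=> [I0 _ _] f0 subf transG invf _.
case: (arg_maxP f I0) => S SI maxS.
(* For [B] of largest mean in [I], the polytope points have exactly the means in
   [[0, mean (indicator R B)]], so the symmetrized problem is one-dimensional. *)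
case: (arg_maxP (fun T => mean (indicator R T)) I0) => B BI maxB.
have /andP[meanB0 _] := mean_indicator_itv R B.
have cF : {within `[0, mean (indicator R B)],
    continuous (fun t => multilinear f (const_vec X t))}%classic.
  exact/continuous_subspaceT/continuous_multilinear_const.
have [c cB maxc] := EVT_max meanB0 cF.
exists (f S), (multilinear f (const_vec X c)); split.
- by split=> [|_ [T TI <-]]; [exists S|exact: maxS].
- split=> [|_ [x xI <-]].
    have [|x xI xc] := polytope_mean_surj (t := c) I0 BI.
      by move: cB; rewrite in_itv.
    by exists x => //; rewrite symmetrizeE// xc.
  rewrite symmetrizeE//; apply: maxc; rewrite in_itv/=.
  exact: polytope_mean_le xI.
(* The mean of the optimal [S] lies in that interval, so the value at [c] dominates the value
   there. *)
have /andP[S0 _] := mean_indicator_itv R S.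
apply: (le_trans (multilinear_const_half subf transG invf f0
  (mean_indicator_itv R S) (card_mean_indicator R S))).
by apply: maxc; rewrite in_itv/= S0; exact: maxB.
Qed.
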